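(* Let $R$ be a commutative ring and $M$ an $R$-module. Then $\mathcal M^*$ is dually separated if and only if $M$ is a flat Mittag-Leffler $R$-module and, for every maximal ideal $\mathfrak m\subset R$, the natural map $$M\otimes_R R/\mathfrak m\to\operatorname{Hom}_R(M^*,R/\mathfrak m),\qquad m\otimes\bar r\mapsto\big(w\mapsto \overline{w(m)r}\big),$$ is injective (where $M^*=\operatorname{Hom}_R(M,R)$).
   Context: An $R$-module $M$ is Mittag-Leffler (in the sense of Raynaud–Gruson) if for every family $\{Q_j\}$ of $R$-modules the canonical map $M\otimes_R\prod_jQ_j\to\prod_j(M\otimes_RQ_j)$ is injective. An $\mathcal R$-module is a covariant functor $\mathbb M$ from commutative $R$-algebras to abelian groups with each $\mathbb M(S)$ an $S$-module, functorially; morphisms are natural transformations $S$-linear on each $S$. For an $R$-module $M$, $\mathcal M(S)=M\otimes_RS$ and $\mathcal M^*(S)=\operatorname{Hom}_S(M\otimes_RS,S)$; generally $\mathbb M^*(S)=\operatorname{Hom}_{\mathcal S}(\mathbb M_{|S},\mathcal S)$ with $\mathbb M_{|S}$ restriction to $S$-algebras. An $\mathcal R$-module $\mathbb M$ is dually separated if for every commutative $R$-algebra $S$ the map $\mathbb M^*(S)\to\operatorname{Hom}_R(\mathbb M(R),S)$, $w\mapsto w_R$, is injective. *)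

(* Defs.v *)
From HB Require Import structures.
From mathcomp Require Import all_boot all_order all_algebra.
Set Implicit Arguments. Unset Strict Implicit. Unset Printing Implicit Defensive.
Import GRing.Theory.
Local Open Scope ring_scope.

Section Defs.
Variable R : comPzRingType.

(* For "R-modules" A, B given by their addition and R-action, a formal sum
   sum_i a_i (x) b_i (given as a list of pairs) is zero in A (x)_R B iff it is
   killed by every R-bilinear map A x B -> P into every R-module P. *)
Definition bilinear_on (A B : Type) (addA : A -> A -> A) (sA : R -> A -> A)
  (addB : B -> B -> B) (sB : R -> B -> B) (P : lmodType R) (beta : A -> B -> P) :=
  [/\ (forall a a' b, beta (addA a a') b = beta a b + beta a' b),
      (forall a b b', beta a (addB b b') = beta a b + beta a b'),
      (forall r a b, beta (sA r a) b = r *: beta a b) &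
      (forall r a b, beta a (sB r b) = r *: beta a b)].

Definition tensor_zero (A B : Type) (addA : A -> A -> A) (sA : R -> A -> A)
  (addB : B -> B -> B) (sB : R -> B -> B) (s : seq (A * B)) : Prop :=
  forall (P : lmodType R) (beta : A -> B -> P),
    bilinear_on addA sA addB sB beta -> \sum_(x <- s) beta x.1 x.2 = 0.

Definition tz (M : lmodType R) (B : Type) (addB : B -> B -> B) (sB : R -> B -> B)
  (s : seq (M * B)) : Prop :=
  @tensor_zero M B +%R *:%R addB sB s.

Definition tzM (M N : lmodType R) (s : seq (M * N)) : Prop :=
  @tz M N +%R *:%R s.

Definition lin_to (M : lmodType R) (S : comPzRingType) (phi : R -> S) (w : M -> S) :=
  forall (r : R) (u v : M), w (r *: u + v) = phi r * w u + w v.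

Definition lin_form (M : lmodType R) (w : M -> R) := @lin_to M R id w.

Definition linmap (N N' : lmodType R) (f : N -> N') :=
  forall (r : R) (u v : N), f (r *: u + v) = r *: f u + f v.

Definition flat (M : lmodType R) : Prop :=
  forall (N N' : lmodType R) (f : N -> N'), linmap f -> injective f ->
  forall s : seq (M * N), tzM (map (fun x => (x.1, f x.2)) s) -> tzM s.

(* the canonical map M (x) prod_j Q_j -> prod_j (M (x) Q_j) is injective *)
Definition prod_add (J : Type) (Q : J -> lmodType R) (x y : forall j, Q j) :
  forall j, Q j := fun j => x j + y j.
Definition prod_scale (J : Type) (Q : J -> lmodType R) (r : R) (x : forall j, Q j) :
  forall j, Q j := fun j => r *: x j.

Definition mittag_leffler (M : lmodType R) : Prop :=
  forall (J : Type) (Q : J -> lmodType R) (s : seq (M * (forall j, Q j))),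
    (forall j, tzM (map (fun x => (x.1, x.2 j)) s)) ->
    @tz M (forall j, Q j) (@prod_add J Q) (@prod_scale J Q) s.

Definition ideal (I : R -> Prop) : Prop :=
  [/\ I 0, (forall x y, I x -> I y -> I (x + y)) & (forall r x, I x -> I (r * x))].

Definition maximal_ideal (I : R -> Prop) : Prop :=
  [/\ ideal I, ~ I 1 &
      forall J : R -> Prop, ideal J -> (forall x, I x -> J x) ->
        (forall x, J x <-> I x) \/ J 1].

Definition quotient_by (I : R -> Prop) (k : comPzRingType) (pi : {rmorphism R -> k}) :=
  (forall c : k, exists r : R, pi r = c) /\ (forall r, pi r = 0 <-> I r).

Definition residue_map_injective (M : lmodType R) (k : comPzRingType)
  (pi : {rmorphism R -> k}) : Prop :=
  forall s : seq (M * k),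
    (forall w : M -> R, lin_form w -> \sum_(x <- s) pi (w x.1) * x.2 = 0) ->
    @tz M k +%R (fun r c => pi r * c) s.

(* An R-algebra is (S, phi : R -> S).  Using the adjunction
   Hom_S(M (x)_R S, S) = Hom_R(M, S), the value  M^*(S)  is represented by the
   R-linear maps w : M -> S (predicate lin_to phi), with S-module structure
   (s . w)(m) = s * w m and functoriality by post-composition. *)

(* An element of (M^* )^*(S): for every S-algebra (T, psi) a map
   eta T psi : M^*(T) -> T, T-linear and natural in morphisms of S-algebras. *)
Definition dual_elt (M : lmodType R) (S : comPzRingType) (phi : {rmorphism R -> S})
  (eta : forall (T : comPzRingType) (psi : {rmorphism S -> T}), (M -> T) -> T) : Prop :=
  (forall (T : comPzRingType) (psi : {rmorphism S -> T}) (t : T) (w w' : M -> T),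
     lin_to (fun r => psi (phi r)) w -> lin_to (fun r => psi (phi r)) w' ->
     eta T psi (fun m => t * w m + w' m) = t * eta T psi w + eta T psi w')
  /\
  (forall (T T' : comPzRingType) (psi : {rmorphism S -> T}) (psi' : {rmorphism S -> T'})
     (g : {rmorphism T -> T'}), (forall s, g (psi s) = psi' s) ->
     forall w : M -> T, lin_to (fun r => psi (phi r)) w ->
       eta T' psi' (fun m => g (w m)) = g (eta T psi w)).

Definition dual_eq (M : lmodType R) (S : comPzRingType) (phi : {rmorphism R -> S})
  (eta1 eta2 : forall (T : comPzRingType) (psi : {rmorphism S -> T}), (M -> T) -> T) : Prop :=
  forall (T : comPzRingType) (psi : {rmorphism S -> T}) (w : M -> T),
    lin_to (fun r => psi (phi r)) w -> eta1 T psi w = eta2 T psi w.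

(* w |-> w_R : M^*(R) = Hom_R(M,R) -> S,  x |-> w_S (image of x in M^*(S)) *)
Definition dual_at_R (M : lmodType R) (S : comPzRingType) (phi : {rmorphism R -> S})
  (eta : forall (T : comPzRingType) (psi : {rmorphism S -> T}), (M -> T) -> T)
  (x : M -> R) : S :=
  eta S idfun (fun m => phi (x m)).

Definition dually_separated_dual (M : lmodType R) : Prop :=
  forall (S : comPzRingType) (phi : {rmorphism R -> S})
         (eta1 eta2 : forall (T : comPzRingType) (psi : {rmorphism S -> T}), (M -> T) -> T),
    dual_elt phi eta1 -> dual_elt phi eta2 ->
    (forall x : M -> R, lin_form x -> dual_at_R phi eta1 x = dual_at_R phi eta2 x) ->
    dual_eq phi eta1 eta2.

End Defs.

(* Main.v *)
Require Import Defs.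
From HB Require Import structures.
From mathcomp Require Import all_boot all_order all_algebra.
From mathcomp Require Import boolp classical_sets.
Set Implicit Arguments. Unset Strict Implicit. Unset Printing Implicit Defensive.
Import GRing.Theory.
Local Open Scope ring_scope.

(* Both sides are equivalent to: M (x) N -> Hom(M^*, N) is injective for every
   R-module N.

   An element of the dual of M^* is determined by its value on the universal
   point M -> S (+) (M (x) S) of a square-zero extension, so it is evaluation at
   an element of M (x) S.  Dual separation is thus the above injectivity for
   N = S an R-algebra, and square-zero extensions R (+) N reach all modules N.

   If M is flat and Mittag-Leffler, every x in M (x) N has a smallest submodule
   N_x such that x comes from M (x) N_x.  It is finitely generated; if it is
   nonzero, it has a simple quotient N_x/A = R/m, and when x is killed by M^*,
   injectivity at m shows that x already comes from M (x) A, a contradiction. *)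

(** * Quotient modules and quotient rings *)

Section ClassQuotient.
Variables (S : pzRingType) (T : Type) (e : T -> T -> Prop).
Variables (z : T) (add : T -> T -> T) (scale : S -> T -> T).
Hypothesis e_refl : forall x, e x x.
Hypothesis e_sym : forall x y, e x y -> e y x.
Hypothesis e_trans : forall x y t, e x y -> e y t -> e x t.
Hypothesis e_add : forall x x' y y', e x x' -> e y y' -> e (add x y) (add x' y').
Hypothesis e_scale : forall a x x', e x x' -> e (scale a x) (scale a x').
Hypothesis e_addA : forall x y t, e (add x (add y t)) (add (add x y) t).
Hypothesis e_addC : forall x y, e (add x y) (add y x).
Hypothesis e_add0 : forall x, e (add z x) x.
Hypothesis e_addN : forall x, e (add (scale (-1) x) x) z.
Hypothesis e_scaleA : forall a b x, e (scale a (scale b x)) (scale (a * b) x).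
Hypothesis e_scale1 : forall x, e (scale 1 x) x.
Hypothesis e_scaleDr : forall a x y,
  e (scale a (add x y)) (add (scale a x) (scale a y)).
Hypothesis e_scaleDl : forall a b x,
  e (scale (a + b) x) (add (scale a x) (scale b x)).

Let Q : Type := {A : T -> Prop | exists x, A = e x}.
Let cl (x : T) : Q := exist _ (e x) (ex_intro _ x erefl).
Let rp (q : Q) : T := sval (cid (svalP q)).

Let clK q : cl (rp q) = q.
Proof. by case: q => A Aq; apply: eq_exist; rewrite /rp; case: cid => x /= ->. Qed.

Let clP x y : cl x = cl y <-> e x y.
Proof.
split=> [[exy]|exy]; first by rewrite exy.
apply: eq_exist; rewrite predeqE => t; split; last exact: e_trans.
by apply: e_trans; exact: e_sym.
Qed.

Let rpK x : e (rp (cl x)) x. Proof. exact/clP/clK. Qed.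

Let addq (p q : Q) := cl (add (rp p) (rp q)).
Let scaleq a (p : Q) := cl (scale a (rp p)).

Let cl_add x y : addq (cl x) (cl y) = cl (add x y).
Proof. by apply/clP/e_add. Qed.
Let cl_scale a x : scaleq a (cl x) = cl (scale a x).
Proof. by apply/clP/e_scale. Qed.

(** The module laws are asked only up to [e], so that [T] can be a type of formal sums, where
    concatenation has no inverses. The opposite of a class is its multiple by [-1]. *)
Lemma class_quotient : exists (L : lmodType S) (pi : T -> L),
  [/\ forall q, exists x, pi x = q,
      forall x y, pi x = pi y <-> e x y,
      pi z = 0,
      forall x y, pi (add x y) = pi x + pi y &
      forall a x, pi (scale a x) = a *: pi x].
Proof.
have addA : associative addq.
  by move=> p q r; rewrite -[p]clK -[q]clK -[r]clK !cl_add; exact/clP.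
have addC : commutative addq.
  by move=> p q; rewrite -[p]clK -[q]clK !cl_add; exact/clP.
have add0 : left_id (cl z) addq.
  by move=> p; rewrite -[p]clK cl_add; exact/clP.
have addN : left_inverse (cl z) (scaleq (-1)) addq.
  by move=> p; rewrite -[p]clK cl_scale cl_add; exact/clP.
have scA a b v : scaleq a (scaleq b v) = scaleq (a * b) v.
  by rewrite -[v]clK !cl_scale; exact/clP.
have sc1 : left_id 1 scaleq by move=> p; rewrite -[p]clK cl_scale; exact/clP.
have scDr : right_distributive scaleq addq.
  by move=> a p q; rewrite -[p]clK -[q]clK !(cl_scale, cl_add); exact/clP.
have scDl v a b : scaleq (a + b) v = addq (scaleq a v) (scaleq b v).
  by rewrite -[v]clK !(cl_scale, cl_add); exact/clP.
pose Qc : choiceType := HB.pack Q (gen_eqMixin Q) (gen_choiceMixin Q).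
pose Qz : zmodType := HB.pack (Qc : Type) Qc
  (GRing.isZmodule.Build Qc addA addC add0 addN).
pose L : lmodType S := HB.pack (Qz : Type) Qz
  (GRing.Zmodule_isLmodule.Build S Qz scA sc1 scDr scDl).
by exists L, cl; split=> // q; exists (rp q).
Qed.

End ClassQuotient.

Section QuotientModule.
Variables (R : pzRingType) (N : lmodType R).

Definition submodule (A : N -> Prop) :=
  A 0 /\ forall r x y, A x -> A y -> A (r *: x + y).

Variables (A : N -> Prop) (subA : submodule A).

Lemma submoduleD x y : A x -> A y -> A (x + y).
Proof. by move=> Ax Ay; rewrite -[x]scale1r; apply: subA.2. Qed.
Lemma submoduleZ r x : A x -> A (r *: x).
Proof. by move=> Ax; rewrite -[_ *: _]addr0; apply: subA.2 => //; case: subA. Qed.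
Lemma submoduleN x : A x -> A (- x).
Proof. by rewrite -scaleN1r; apply: submoduleZ. Qed.

Lemma quotient_module : exists (Q : lmodType R) (pi : N -> Q),
  [/\ forall q, exists x, pi x = q,
      forall x y, pi x = pi y <-> A (x - y) &
      forall r x y, pi (r *: x + y) = r *: pi x + pi y].
Proof.
have [A0 _] := subA.
have [||||||||||||| Q [pi [sur ker _ piD piZ]]] :=
  @class_quotient R N (fun x y => A (x - y)) 0 +%R *:%R.
- by move=> x; rewrite subrr.
- by move=> x y /submoduleN; rewrite opprB.
- by move=> x y t xy /(submoduleD xy); rewrite addrA subrK.
- by move=> x x' y y' xx' /(submoduleD xx'); rewrite addrACA -opprD.
- by move=> a x x' /(submoduleZ a); rewrite scalerBr.
- by move=> x y t; rewrite [x + _]addrA subrr.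
- by move=> x y; rewrite [x + y]addrC subrr.
- by move=> x; rewrite add0r subrr.
- by move=> x; rewrite scaleN1r addNr subrr.
- by move=> a b x; rewrite scalerA subrr.
- by move=> x; rewrite scale1r subrr.
- by move=> a x y; rewrite scalerDr subrr.
- by move=> a b x; rewrite scalerDl subrr.
by exists Q, pi; split=> // r x y; rewrite piD piZ.
Qed.

End QuotientModule.

(** The condition at maximal ideals speaks of a given quotient ring, so one has to be built before
    that condition can be applied. *)
Lemma quotient_ring (R : comPzRingType) (I : R -> Prop) : ideal I ->
  exists (k : comPzRingType) (pi : {rmorphism R -> k}), quotient_by I pi.
Proof.
move=> [I0 ID IM].
have subI : @submodule R R^o I by split=> // r x y Ix Iy; apply/ID/Iy/IM.
have [Q [pi [sur ker lin]]] := quotient_module subI.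
have piB : {morph pi : x y / x - y}.
  by move=> x y; rewrite -scaleN1r addrC lin scaleN1r addrC.
have [rp rpK] := choice sur.
have IMM x x' y y' : I (x - x') -> I (y - y') -> I (x * y - x' * y').
  move=> Ix Iy; have -> : x * y - x' * y' = y * (x - x') + x' * (y - y').
    by rewrite !mulrBr ![y * _]mulrC addrA subrK.
  by apply: ID; apply: IM.
pose mul (p q : Q) : Q := pi (rp p * rp q).
have piM x y : mul (pi x) (pi y) = pi (x * y).
  by apply/ker/IMM; apply/ker; rewrite rpK.
have mulA : associative mul.
  by move=> p q r; rewrite -[p]rpK -[q]rpK -[r]rpK !piM mulrA.
have mulC : commutative mul by move=> p q; rewrite /mul mulrC.
have mul1 : left_id (pi 1) mul by move=> p; rewrite -[p]rpK piM mul1r.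
have piD : {morph pi : x y / x + y}.
  by move=> x y; have := lin 1 x y; rewrite !scale1r.
have mulDl : left_distributive mul +%R.
  by move=> p q r; rewrite -[p]rpK -[q]rpK -[r]rpK -piD !piM -piD -mulrDl.
pose k : comPzRingType := HB.pack (Q : Type) Q
  (GRing.Zmodule_isComPzRing.Build Q mulA mulC mul1 mulDl).
pose f : R -> k := pi.
have fB : {morph f : x y / x - y} by [].
have fM : GRing.monoid_morphism f by split=> // x y; rewrite /f -piM.
pose F : {rmorphism R -> k} := HB.pack f (GRing.isZmodMorphism.Build R k f fB)
  (GRing.isMonoidMorphism.Build R k f fM).
exists k, F; split; first exact: sur.
move=> r; rewrite -{2}[r]subr0 -ker -/(f r) -/(f 0) -[f 0]/(F 0).
by rewrite rmorph0.
Qed.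

(** * Restriction of scalars and tensor products *)

(** The alias keeps the action of [R] apart from that of [S]; with [phi] in the type, the action of
    [R] can be inferred. *)
Definition restrict (R S : pzRingType) (phi : {rmorphism R -> S})
  (B : lmodType S) : Type := B.

Section RestrictionOfScalars.
Variables (R S : pzRingType) (phi : {rmorphism R -> S}) (B : lmodType S).
Let scale (r : R) (b : restrict phi B) : restrict phi B := phi r *: (b : B).
HB.instance Definition _ := GRing.Zmodule.on (restrict phi B).
Fact restrict_scaleA a b v : scale a (scale b v) = scale (a * b) v.
Proof. by rewrite /scale rmorphM scalerA. Qed.
Fact restrict_scale1 : left_id 1 scale.
Proof. by move=> v; rewrite /scale rmorph1 scale1r. Qed.
Fact restrict_scaleDr : right_distributive scale +%R.
Proof. by move=> a u v; rewrite /scale scalerDr. Qed.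
Fact restrict_scaleDl v : {morph scale^~ v : a b / a + b}.
Proof. by move=> a b; rewrite /scale rmorphD scalerDl. Qed.
HB.instance Definition _ := GRing.Zmodule_isLmodule.Build R (restrict phi B)
  restrict_scaleA restrict_scale1 restrict_scaleDr restrict_scaleDl.
End RestrictionOfScalars.

Lemma linmap0 (R : comPzRingType) (N N' : lmodType R) (f : N -> N') :
  linmap f -> f 0 = 0.
Proof.
by move=> lin; apply: (addrI (f 0)); have := lin 1 0 0; rewrite !scale1r !addr0.
Qed.

Lemma linmapZ (R : comPzRingType) (N N' : lmodType R) (f : N -> N') r u :
  linmap f -> f (r *: u) = r *: f u.
Proof. by move=> lin; rewrite -[r *: u]addr0 lin (linmap0 lin) addr0. Qed.

Lemma linmap_sum (R : comPzRingType) (M N N' : lmodType R) (f : N -> N')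
    (w : M -> R) (s : seq (M * N)) : linmap f ->
  f (\sum_(x <- s) w x.1 *: x.2) = \sum_(x <- s) w x.1 *: f x.2.
Proof.
move=> lin; elim: s => [|x s IHs]; first by rewrite !big_nil (linmap0 lin).
by rewrite !big_cons lin IHs.
Qed.

Section Bilinear.
Variables (R : comPzRingType) (M N P : lmodType R).

Definition is_bilinear (beta : M -> N -> P) :=
  bilinear_on +%R *:%R +%R *:%R beta.

Lemma is_bilinearI (beta : M -> N -> P) :
  (forall r m m' n, beta (r *: m + m') n = r *: beta m n + beta m' n) ->
  (forall r m n n', beta m (r *: n + n') = r *: beta m n + beta m n') ->
  is_bilinear beta.
Proof.
move=> linl linr.
have b0l n : beta 0 n = 0.
  by apply: (addrI (beta 0 n)); have := linl 1 0 0 n; rewrite !scale1r !addr0.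
have b0r m : beta m 0 = 0.
  by apply: (addrI (beta m 0)); have := linr 1 m 0 0; rewrite !scale1r !addr0.
split=> [m m' n|m n n'|r m n|r m n].
- by have := linl 1 m m' n; rewrite !scale1r.
- by have := linr 1 m n n'; rewrite !scale1r.
- by have := linl r m 0 n; rewrite b0l !addr0.
- by have := linr r m n 0; rewrite b0r !addr0.
Qed.

Variables (beta : M -> N -> P) (bil : is_bilinear beta).

Lemma is_bilinearDl m m' n : beta (m + m') n = beta m n + beta m' n.
Proof. by case: bil. Qed.
Lemma is_bilinearDr m n n' : beta m (n + n') = beta m n + beta m n'.
Proof. by case: bil. Qed.
Lemma is_bilinearZl r m n : beta (r *: m) n = r *: beta m n.
Proof. by case: bil. Qed.
Lemma is_bilinearZr r m n : beta m (r *: n) = r *: beta m n.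
Proof. by case: bil. Qed.
Lemma is_bilinear0r m : beta m 0 = 0.
Proof. by rewrite -[0](scale0r 0) is_bilinearZr scale0r. Qed.
Lemma is_bilinearNr m n : beta m (- n) = - beta m n.
Proof. by rewrite -scaleN1r is_bilinearZr scaleN1r. Qed.

End Bilinear.

Definition scale_snd (S : pzRingType) (M : Type) (B : lmodType S) (a : S)
  (x : seq (M * B)) := [seq (y.1, a *: y.2) | y <- x].

(* [M (x)_R B] with the S-module structure coming from [B]. *)
Lemma tensor_product (R S : comPzRingType) (phi : {rmorphism R -> S})
    (M : lmodType R) (B : lmodType S) :
  exists (L : lmodType S) (t : M -> B -> L),
  [/\ forall r m m' b, t (r *: m + m') b = phi r *: t m b + t m' b,
      forall m, linmap (t m),
      forall q, exists x, q = \sum_(y <- x) t y.1 y.2 &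
      forall x y : seq (M * B),
        \sum_(z <- x) t z.1 z.2 = \sum_(z <- y) t z.1 z.2 ->
      forall (P : lmodType R) (beta : M -> restrict phi B -> P), is_bilinear beta ->
        \sum_(z <- x) beta z.1 z.2 = \sum_(z <- y) beta z.1 z.2].
Proof.
(* Formal sums are identified when no [R]-bilinear map separates them, so the universal property
   holds by construction. *)
pose e (x y : seq (M * B)) :=
  forall (P : lmodType R) (beta : M -> restrict phi B -> P), is_bilinear beta ->
  \sum_(z <- x) beta z.1 z.2 = \sum_(z <- y) beta z.1 z.2.
have [||||||||||||| L [pi [sur ker pi0 piD piZ]]] :=
  @class_quotient S (seq (M * B)) e [::] cat (@scale_snd S M B).
- by [].
- by move=> x y exy P beta bil; rewrite (exy P beta bil).
- by move=> x y z exy eyz P beta bil; rewrite (exy P beta bil); exact: eyz.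
- by move=> x x' y y' ex ey P beta bil; rewrite !big_cat /= (ex P beta bil) (ey P beta bil).
- move=> a x x' ex P beta bil; rewrite !big_map /=.
  (* As [S] is commutative, multiplying the second variable by [a] keeps [beta] bilinear over
     [R]. *)
  apply: (ex P (fun m b => beta m (a *: b))).
  apply: is_bilinearI => [r m m' n|r m n n'].
    by rewrite (is_bilinearDl bil) (is_bilinearZl bil).
  rewrite -(is_bilinearZr bil) -(is_bilinearDr bil); congr (beta _ _).
  have -> : r *: (a *: n : restrict phi B) = a *: (phi r *: n : B).
    by rewrite [LHS](scalerA (phi r) a n) scalerA mulrC.
  exact: (scalerDr a (phi r *: n)).
- by move=> x y z P beta bil; rewrite catA.
- by move=> x y P beta bil; rewrite !big_cat /= addrC.
- by [].
- move=> x P beta bil; rewrite big_cat big_map big_nil /= -big_split big1 //= => z _.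
  by rewrite scaleN1r (is_bilinearNr bil) addNr.
- move=> a b x P beta bil; rewrite !big_map /=.
  by apply: eq_bigr => z _; rewrite scalerA.
- move=> x P beta bil; rewrite !big_map /=.
  by apply: eq_bigr => z _; rewrite scale1r.
- by move=> a x y P beta bil; rewrite /scale_snd map_cat.
- move=> a b x P beta bil; rewrite big_cat !big_map /= -big_split.
  by apply: eq_bigr => z _; rewrite scalerDl (is_bilinearDr bil).
pose t m b := pi [:: (m, b)].
have pit x : pi x = \sum_(y <- x) t y.1 y.2.
  elim: x => [|[m b] x IHx]; first by rewrite big_nil.
  by rewrite big_cons -IHx -piD.
exists L, t; split.
- move=> r m m' b; rewrite -piZ -piD; apply/ker => P beta bil.
  by rewrite !big_cons !big_nil /= !addr0 (is_bilinearDl bil) (is_bilinearZl bil)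
    -(is_bilinearZr bil).
- move=> m s b b'; rewrite -piZ -piD; apply/ker => P beta bil.
  by rewrite !big_cons !big_nil /= !addr0 -(is_bilinearDr bil).
- by move=> q; have [x <-] := sur q; exists x; exact: pit.
- by move=> x y; rewrite -!pit => /ker.
Qed.

(** * Square-zero extensions *)

(** The alias avoids the componentwise product that pairs carry when [L] is itself a ring, as for
    [T^o]. *)
Definition trivext (S : comPzRingType) (L : lmodType S) : Type := (S * L)%type.

Section TrivialExtension.
Variables (S : comPzRingType) (L : lmodType S).
HB.instance Definition _ := GRing.Zmodule.copy (trivext L) (S * L)%type.
Let one : trivext L := (1, 0).
Let mul (x y : trivext L) : trivext L := (x.1 * y.1, x.1 *: y.2 + y.1 *: x.2).
Fact trivext_mulC : commutative mul.
Proof. by move=> x y; rewrite /mul mulrC addrC. Qed.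
Fact trivext_mul1 : left_id one mul.
Proof. by case=> x l; rewrite /mul /= mul1r scale1r scaler0 addr0. Qed.
Fact trivext_mulA : associative mul.
Proof.
move=> x y z; congr pair => /=; first by rewrite mulrA.
by rewrite !scalerDr !scalerA addrA ![_ * z.1]mulrC.
Qed.
Fact trivext_mulDl : left_distributive mul +%R.
Proof.
move=> x y z; congr pair => /=; first by rewrite mulrDl.
by rewrite scalerDl scalerDr addrACA.
Qed.
HB.instance Definition _ := GRing.Zmodule_isComPzRing.Build (trivext L)
  trivext_mulA trivext_mulC trivext_mul1 trivext_mulDl.

Definition trivext_in (s : S) : trivext L := (s, 0).
Fact trivext_in_zmod_morphism : zmod_morphism trivext_in.
Proof. by move=> x y; congr pair; rewrite /= subrr. Qed.
Fact trivext_in_monoid_morphism : GRing.monoid_morphism trivext_in.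
Proof. by split=> // x y; congr pair; rewrite /= !scaler0 addr0. Qed.
HB.instance Definition _ := GRing.isZmodMorphism.Build S (trivext L) trivext_in
  trivext_in_zmod_morphism.
HB.instance Definition _ := GRing.isMonoidMorphism.Build S (trivext L) trivext_in
  trivext_in_monoid_morphism.

End TrivialExtension.

(** Naturality of a dual element concerns ring morphisms only; this lets it be applied to a linear
    map out of [M (x) S]. *)
Lemma trivext_map (S T : comPzRingType) (L : lmodType S) (K : lmodType T)
    (psi : {rmorphism S -> T}) (h : L -> K) :
  (forall s u v, h (s *: u + v) = psi s *: h u + h v) ->
  exists F : {rmorphism trivext L -> trivext K},
    forall s l, F (s, l) = (psi s, h l).
Proof.
move=> lin.
have hD u v : h (u + v) = h u + h v by have := lin 1 u v; rewrite rmorph1 !scale1r.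
have h0 : h 0 = 0 by apply: (addrI (h 0)); rewrite -hD !addr0.
have hZ s u : h (s *: u) = psi s *: h u by rewrite -[s *: u]addr0 lin h0 addr0.
pose f (x : trivext L) : trivext K := (psi x.1, h x.2).
have fB : zmod_morphism f.
  move=> x y; congr pair; first exact: rmorphB.
  by rewrite /= -!scaleN1r hD hZ rmorphN1.
have fM : GRing.monoid_morphism f.
  split=> [|x y]; first by rewrite /f /= rmorph1 h0.
  by rewrite /f /= rmorphM hD !hZ.
pose F : {rmorphism trivext L -> trivext K} :=
  HB.pack f (GRing.isZmodMorphism.Build _ _ f fB)
    (GRing.isMonoidMorphism.Build _ _ f fM).
by exists F.
Qed.

(** * Elements of the dual of M^* as evaluations *)

Lemma lin_to_bilinear (R S T : comPzRingType) (M : lmodType R)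
    (phi : {rmorphism R -> S}) (psi : {rmorphism S -> T}) (w : M -> T) :
  lin_to (psi \o phi) w ->
  is_bilinear (fun m (s : restrict phi S^o) =>
    w m * psi s : restrict (psi \o phi) T^o).
Proof.
move=> linw; apply: is_bilinearI => r m n n'.
  by rewrite linw mulrDl -mulrA.
by rewrite rmorphD [psi (r *: n)](rmorphM psi) mulrDr mulrCA.
Qed.

(** A Yoneda argument: up to the factor [(0, 1)], every [w : M -> T] is the image of the universal
    point [w0] under a ring morphism, so naturality and linearity determine [eta] from its value at
    [w0]. *)
Lemma dual_elt_evaluation (R S : comPzRingType) (M : lmodType R)
    (phi : {rmorphism R -> S})
    (eta : forall (T : comPzRingType) (psi : {rmorphism S -> T}), (M -> T) -> T) :
  dual_elt phi eta ->
  exists x : seq (M * S), forall (T : comPzRingType) (psi : {rmorphism S -> T}) (w : M -> T),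
    lin_to (psi \o phi) w -> eta T psi w = \sum_(y <- x) w y.1 * psi y.2.
Proof.
move=> [eta_lin eta_nat].
have [L [t [tl tr tsur tlift]]] := tensor_product phi M S^o.
have tZ m a b : t m (a * b) = a *: t m b by exact: (linmapZ a b (tr m)).
pose i : {rmorphism S -> trivext L} := @trivext_in S L.
pose w0 m : trivext L := (0, t m 1).
have linw0 : lin_to (fun r => i (phi r)) w0.
  move=> r u v; rewrite /w0 tl; congr pair; first by rewrite /= mulr0 addr0.
  by rewrite /= scaler0 addr0.
case etaw0 : (eta _ i w0) => [a l].
have [x lx] := tsur l.
exists x => T psi w linw.
have [rep repK] := choice tsur.
(* The map [m (x) s |-> w m * psi s] on [L], computed on chosen representatives; [hE] is its
   independence of the choice. *)
pose h q : T := \sum_(y <- rep q) w y.1 * psi y.2.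
have hE z : h (\sum_(y <- z) t y.1 y.2) = \sum_(y <- z) w y.1 * psi y.2.
  by apply: (tlift _ z _ _ _ (lin_to_bilinear linw)); rewrite -repK.
have hlin s u v : h (s *: u + v) = psi s *: (h u : T^o) + h v.
  rewrite (repK u) (repK v) scaler_sumr.
  under eq_bigr do rewrite -tZ.
  rewrite -(big_map (fun y => (y.1, s * y.2)) xpredT (fun y => t y.1 y.2)) /=.
  rewrite -big_cat !hE big_cat big_map scaler_sumr; congr (_ + _).
  by apply: eq_bigr => y _; rewrite /= rmorphM mulrCA.
have [F FE] := @trivext_map S T L T^o psi h hlin.
pose j : {rmorphism T -> trivext T^o} := @trivext_in T T^o.
have h0 : h 0 = 0 by have := hE [::]; rewrite !big_nil.
have Fi s : F (i s) = j (psi s) by rewrite /i /j /= /trivext_in FE h0.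
have := eta_nat _ _ i (j \o psi) F Fi w0 linw0.
(* The added [0] gives the shape to which [eta_lin] applies. *)
have -> : (fun m => F (w0 m)) = fun m => ((0, 1) : trivext T^o) * j (w m) + 0.
  apply/funext => m; rewrite FE addr0; congr pair; rewrite ?mul0r ?rmorph0 //=.
  have := hE [:: (m, 1)]; rewrite !big_seq1 /= rmorph1 mulr1 => ->.
  by rewrite scale0r add0r [LHS](esym (mulr1 _)).
have linj : lin_to (fun r => (j \o psi) (phi r)) (fun m => j (w m)).
  by move=> r u v; rewrite linw rmorphD rmorphM.
have lin0 : lin_to (fun r => (j \o psi) (phi r)) (fun _ : M => 0 : trivext T^o).
  by move=> r u v; rewrite mulr0 addr0.
have eta0 : eta _ (j \o psi) (fun _ => 0) = 0.
  have := eta_lin _ (j \o psi) 1 _ _ lin0 lin0.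
  rewrite [in RHS]mul1r; have -> : (fun _ : M => 1 * 0 + 0) = (fun _ => 0 : trivext T^o).
    by apply/funext => m; rewrite mulr0 addr0.
  move=> e0.
  by apply: (addrI (eta _ (j \o psi) (fun _ => 0))); rewrite addr0.
(* Linearity takes out [(0, 1)] and naturality along [j] takes out [j]; the second components then
   say that [eta] at [w] is [h l]. *)
rewrite (eta_lin _ (j \o psi) (0, 1) (fun m => j (w m)) (fun _ => 0)) //.
rewrite eta0 addr0 (eta_nat _ _ psi (j \o psi) j) // etaw0 FE => -[_].
by rewrite /= scale0r add0r lx hE -[LHS]/(_ * 1) mulr1.
Qed.

(** * Dual separation as injectivity of M (x) N -> Hom(M^*, N) *)

(** These are also known as trace modules. *)
Definition universally_torsionless (R : comPzRingType) (M : lmodType R) :=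
  forall (N : lmodType R) (s : seq (M * N)),
    (forall w : M -> R, lin_form w -> \sum_(x <- s) w x.1 *: x.2 = 0) -> tzM s.

(** Both dual elements are evaluations at elements of [M (x) S]. Agreement on [M^*] means that all
    linear forms kill the difference of these elements, which is then zero by the case [N = S]. *)
Lemma universally_torsionless_dually_separated (R : comPzRingType) (M : lmodType R) :
  universally_torsionless M -> dually_separated_dual M.
Proof.
move=> tlM S phi eta1 eta2 d1 d2 eqR T psi w linw.
have [x1 E1] := dual_elt_evaluation d1.
have [x2 E2] := dual_elt_evaluation d2.
pose x : seq (M * restrict phi S^o) := x1 ++ [seq (y.1, - y.2) | y <- x2].
have sumx (U : zmodType) (g : M -> S -> U) : (forall m, {morph g m : s / - s}) ->
    \sum_(y <- x) g y.1 y.2 = \sum_(y <- x1) g y.1 y.2 - \sum_(y <- x2) g y.1 y.2.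
  move=> gN; rewrite big_cat big_map -sumrN; congr (_ + _).
  by apply: eq_bigr => y _; rewrite -gN.
apply/eqP; rewrite -subr_eq0 E1 // E2 //; apply/eqP.
rewrite -(sumx _ (fun m s => w m * psi s)); last first.
  by move=> m s; rewrite rmorphN mulrN.
have tzx : tzM x.
  apply: tlM => u linu; rewrite (sumx _ (fun m s => phi (u m) * s)); last first.
    by move=> m s; rewrite mulrN.
  have linpu : lin_to (idfun \o phi) (fun m => phi (u m)).
    by move=> r a b; rewrite linu rmorphD rmorphM.
  by have := eqR u linu; rewrite /dual_at_R E1 // E2 // => ->; rewrite subrr.
exact: tzx (lin_to_bilinear linw).
Qed.

(** Over [R (+) N], evaluation at the image of [s] is a dual element that vanishes on [M^*]. By
    separation it vanishes at the universal point too, where its value is the tensor itself. *)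
Lemma dually_separated_universally_torsionless (R : comPzRingType) (M : lmodType R) :
  dually_separated_dual M -> universally_torsionless M.
Proof.
move=> sepM N s wt0 P beta bil.
pose phi : {rmorphism R -> trivext N} := @trivext_in R N.
pose sn n : trivext N := (0, n).
pose ev (T : comPzRingType) (psi : {rmorphism trivext N -> T}) (w : M -> T) :=
  \sum_(y <- s) w y.1 * psi (sn y.2).
have [L [t [tl tr _ tlift]]] := tensor_product phi M (trivext N)^o.
have tZ m a b : t m (a * b) = a *: t m b by exact: (linmapZ a b (tr m)).
have dev : dual_elt phi ev.
  split=> [T psi a w w' _ _|T T' psi psi' g gpsi w _]; rewrite /ev.
    rewrite mulr_sumr -big_split; apply: eq_bigr => y _.
    by rewrite mulrDl mulrA.
  by rewrite rmorph_sum; apply: eq_bigr => y _; rewrite rmorphM gpsi.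
have d0 : dual_elt phi (fun T psi (w : M -> T) => 0).
  by split=> *; rewrite ?mulr0 ?addr0 ?rmorph0.
pose i : {rmorphism trivext N -> trivext L} := @trivext_in _ L.
pose w0 m : trivext L := (0, t m 1).
have linw0 : lin_to (fun r => i (phi r)) w0.
  move=> r u v; rewrite /w0 tl; congr pair; first by rewrite /= mulr0 addr0.
  by rewrite /= scaler0 addr0.
have sum_t z : \sum_(y <- z) w0 y.1 * i (sn y.2)
             = (0, \sum_(y <- z) t y.1 (sn y.2)).
  elim: z => [|y z IHz]; first by rewrite !big_nil.
  rewrite !big_cons IHz; congr pair; first by rewrite /= mul0r addr0.
  by rewrite /= scale0r add0r -tZ mulr1.
have evE := sepM _ phi _ _ dev d0 _ _ i w0 linw0.
have tensor0 : \sum_(y <- [seq (y.1, sn y.2) | y <- s]) t y.1 y.2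
             = \sum_(y <- [::]) t y.1 y.2.
  rewrite big_nil big_map.
  suff [] : (0, \sum_(y <- s) t y.1 (sn y.2)) = 0 :> trivext L by [].
  rewrite -sum_t; apply: evE => u linu; rewrite /dual_at_R /ev.
  have sum_u z : \sum_(y <- z) phi (u y.1) * sn y.2
               = (0, \sum_(y <- z) u y.1 *: y.2).
    elim: z => [|y z IHz]; first by rewrite !big_nil.
    rewrite !big_cons IHz; congr pair; first by rewrite /= mulr0 addr0.
    by rewrite /= scaler0 addr0.
  by rewrite sum_u wt0.
(* The projection [R (+) N -> N] is [R]-linear and splits [sn], so vanishing in [M (x) (R (+) N)]
   gives vanishing in [M (x) N]. *)
have bil' : is_bilinear (fun m (b : restrict phi (trivext N)^o) => beta m b.2).
  apply: is_bilinearI => r m n n'.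
    by rewrite (is_bilinearDl bil) (is_bilinearZl bil).
  by rewrite -(is_bilinearZr bil) -(is_bilinearDr bil) /= scaler0 addr0.
by have := tlift _ _ tensor0 P _ bil'; rewrite big_nil big_map.
Qed.

(** * Necessity of the three conditions *)

(** Its operations are [prod_add] and [prod_scale], so [tzM] over it is convertible to the vanishing
    in [mittag_leffler]. *)
Definition product_module (R : comPzRingType) (J : Type) (Q : J -> lmodType R) : Type :=
  forall j, Q j.

Section ProductModule.
Variables (R : comPzRingType) (J : Type) (Q : J -> lmodType R).
HB.instance Definition _ := gen_eqMixin (product_module Q).
HB.instance Definition _ := gen_choiceMixin (product_module Q).
Let addp : product_module Q -> product_module Q -> product_module Q := @prod_add R J Q.
Let oppp (x : product_module Q) : product_module Q := fun j => - x j.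
Let zerop : product_module Q := fun j => 0.
Fact product_addA : associative addp.
Proof. by move=> x y z; apply: functional_extensionality_dep => j; exact: addrA. Qed.
Fact product_addC : commutative addp.
Proof. by move=> x y; apply: functional_extensionality_dep => j; exact: addrC. Qed.
Fact product_add0 : left_id zerop addp.
Proof. by move=> x; apply: functional_extensionality_dep => j; exact: add0r. Qed.
Fact product_addN : left_inverse zerop oppp addp.
Proof. by move=> x; apply: functional_extensionality_dep => j; exact: addNr. Qed.
HB.instance Definition _ := GRing.isZmodule.Build (product_module Q)
  product_addA product_addC product_add0 product_addN.
Let scalep : R -> product_module Q -> product_module Q := @prod_scale R J Q.
Fact product_scaleA a b v : scalep a (scalep b v) = scalep (a * b) v.
Proof. by apply: functional_extensionality_dep => j; exact: scalerA. Qed.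
Fact product_scale1 : left_id 1 scalep.
Proof. by move=> v; apply: functional_extensionality_dep => j; exact: scale1r. Qed.
Fact product_scaleDr : right_distributive scalep +%R.
Proof. by move=> a u v; apply: functional_extensionality_dep => j; exact: scalerDr. Qed.
Fact product_scaleDl v : {morph scalep^~ v : a b / a + b}.
Proof. by move=> a b; apply: functional_extensionality_dep => j; exact: scalerDl. Qed.
HB.instance Definition _ := GRing.Zmodule_isLmodule.Build R (product_module Q)
  product_scaleA product_scale1 product_scaleDr product_scaleDl.
End ProductModule.

Lemma lin_form_bilinear (R : comPzRingType) (M N : lmodType R) (w : M -> R) :
  lin_form w -> is_bilinear (fun m (n : N) => w m *: n).
Proof.
move=> linw; apply: is_bilinearI => r m n n'.
  by rewrite linw scalerDl scalerA.
by rewrite scalerDr !scalerA mulrC.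
Qed.

Section UniversallyTorsionless.
Variables (R : comPzRingType) (M : lmodType R).
Hypothesis tlM : universally_torsionless M.

(** [M (x) -] embeds in [Hom(M^*, -)], which preserves injections. *)
Lemma universally_torsionless_flat : flat M.
Proof.
move=> N N' f linf injf s tz0; apply: tlM => w linw.
apply: injf; rewrite (linmap_sum _ _ linf) (linmap0 linf).
by have := tz0 _ _ (lin_form_bilinear N' linw); rewrite big_map.
Qed.

(** [Hom(M^*, -)] commutes with products, so linear forms can be tested factor by factor. *)
Lemma universally_torsionless_mittag_leffler : mittag_leffler M.
Proof.
move=> J Q s tz0; apply: (@tlM (product_module Q) s) => w linw.
apply: functional_extensionality_dep => j.
rewrite (@linmap_sum R M (product_module Q) (Q j) (fun q => q j)) //.
by have := tz0 j _ _ (lin_form_bilinear (Q j) linw); rewrite big_map.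
Qed.

Lemma universally_torsionless_residue (k : comPzRingType)
  (pi : {rmorphism R -> k}) : residue_map_injective M pi.
Proof. by move=> s wt0; apply: (@tlM (restrict pi k^o) s) => w; exact: wt0. Qed.

End UniversallyTorsionless.

(** * Smallest supporting submodules and maximal submodules *)

Section Support.
Variables (R : comPzRingType) (M N : lmodType R).
Implicit Types (A : N -> Prop) (s : seq (M * N)).

(* [s] vanishes in [M (x) N/A]. *)
Definition vanishes_mod A s :=
  forall (P : lmodType R) (beta : M -> N -> P), is_bilinear beta ->
    (forall m n, A n -> beta m n = 0) -> \sum_(x <- s) beta x.1 x.2 = 0.

(** Bilinear maps on [M x N] that kill [A] are the same as bilinear maps on [M x N/A]. *)
Lemma vanishes_modP A s (Q : lmodType R) (pi : N -> Q) :
  linmap pi -> (forall q, exists x, pi x = q) ->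
  (forall x y, pi x = pi y <-> A (x - y)) ->
  vanishes_mod A s <-> tzM [seq (x.1, pi x.2) | x <- s].
Proof.
move=> lin sur ker; split=> [van P beta bil|tz0 P beta bil beta0].
  rewrite big_map; apply: (van P (fun m n => beta m (pi n))).
    apply: is_bilinearI => r m n n'.
      by rewrite (is_bilinearDl bil) (is_bilinearZl bil).
    by rewrite lin (is_bilinearDr bil) (is_bilinearZr bil).
  move=> m n An; have -> : pi n = 0; last exact: is_bilinear0r bil m.
  by rewrite -(linmap0 lin); apply/ker; rewrite subr0.
have [rep repK] := choice sur.
have repE m n : beta m (rep (pi n)) = beta m n.
  apply/eqP; rewrite -subr_eq0 -(is_bilinearNr bil) -(is_bilinearDr bil).
  by apply/eqP/beta0/ker; rewrite repK.
have bil' : is_bilinear (fun m q => beta m (rep q)).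
  apply: is_bilinearI => r m q q'.
    by rewrite (is_bilinearDl bil) (is_bilinearZl bil).
  by rewrite -[q]repK -[q']repK -lin !repE (is_bilinearDr bil) (is_bilinearZr bil).
by have := tz0 _ _ bil'; rewrite big_map; under eq_bigr do rewrite repE.
Qed.

(** Vanishing in [M (x) N/A] means coming from [M (x) A]; for [M] flat and Mittag-Leffler this
    intersection is itself such an [A], hence the smallest one. *)
Definition support s (n : N) := forall A, submodule A -> vanishes_mod A s -> A n.

Lemma support_submodule s : submodule (support s).
Proof.
split=> [A [A0 _] _ //|r x y sx sy A subA van].
by apply: subA.2; [exact: sx|exact: sy].
Qed.

(* [N / support s] embeds in the product of the [N / A], so flatness and the
   Mittag-Leffler property together let [s] vanish modulo the intersection. *)
Lemma vanishes_mod_support s :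
  flat M -> mittag_leffler M -> vanishes_mod (support s) s.
Proof.
move=> flM mlM.
have [Q0 [pi0 [sur0 ker0 lin0]]] := quotient_module (support_submodule s).
pose J := {A : N -> Prop | submodule A /\ vanishes_mod A s}.
have [Q HQ] := choice (fun j : J => quotient_module (svalP j).1).
have [pi Hpi] : exists pi : forall j, N -> Q j, forall j,
    [/\ forall q, exists x, pi j x = q,
        forall x y, pi j x = pi j y <-> sval j (x - y) & linmap (pi j)].
  exists (fun j => sval (cid (HQ j))) => j; by case: cid.
apply/(vanishes_modP _ lin0 sur0 ker0).
have [rep repK] := choice sur0.
(* The map from [N / support s] to the product of all [N / A]; its injectivity is the definition of
   the support. *)
pose f q : product_module Q := fun j => pi j (rep q).
have fE n : f (pi0 n) = fun j => pi j n.
  apply: functional_extensionality_dep => j.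
  have [_ kerj _] := Hpi j; apply/kerj.
  by have /ker0 := repK (pi0 n); apply; [exact: (svalP j).1|exact: (svalP j).2].
apply: (flM _ (product_module Q) f).
- move=> r u v; rewrite -[u]repK -[v]repK -lin0 !fE.
  by apply: functional_extensionality_dep => j; have [_ _ ->] := Hpi j.
- move=> u v; rewrite -[u]repK -[v]repK !fE => eqf; apply/ker0 => A subA van.
  pose j : J := exist _ A (conj subA van).
  by have [_ kerj _] := Hpi j; apply/(kerj (rep u) (rep v)); rewrite (congr1 (@^~ j) eqf).
- rewrite -map_comp; apply: (mlM J Q) => j; rewrite -map_comp.
  have [surj kerj linj] := Hpi j.
  have /(vanishes_modP _ linj surj kerj) := (svalP j).2.
  by congr (tzM _); apply: eq_map => x /=; rewrite fE.
Qed.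

(* Right exactness of [M (x) -]: [s] comes from [M (x) A]. *)
Lemma vanishes_mod_repr A s : submodule A -> vanishes_mod A s ->
  exists y : seq (M * N), (forall x, x \in y -> A x.2) /\
    forall (P : lmodType R) (beta : M -> N -> P), is_bilinear beta ->
      \sum_(x <- s) beta x.1 x.2 = \sum_(x <- y) beta x.1 x.2.
Proof.
move=> subA van.
have [L [t [tl tr _ tlift]]] := tensor_product idfun M N.
(* [B] is the image of [M (x) A] in [M (x) N]. The map [(m, n) |-> m (x) n] modulo [B] is bilinear
   and kills [A], so the hypothesis puts [s] in [B]. *)
pose B l := exists y : seq (M * N),
  (forall x, x \in y -> A x.2) /\ l = \sum_(x <- y) t x.1 x.2.
have subB : submodule B.
  split; first by exists [::]; rewrite big_nil.
  move=> r _ _ [y [Ay ->]] [y' [Ay' ->]]; exists (scale_snd r y ++ y'); split.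
    move=> x; rewrite mem_cat => /orP[/mapP[z /Ay Az ->]|/Ay' //].
    exact: (submoduleZ subA).
  rewrite big_cat big_map scaler_sumr; congr (_ + _).
  by apply: eq_bigr => x _; rewrite (linmapZ _ _ (tr _)).
have [Q [pi [_ ker lin]]] := quotient_module subB.
have bil : is_bilinear (fun m n => pi (t m n)).
  by apply: is_bilinearI => r m n n'; rewrite (tl, tr) lin.
have pi_sum : pi (\sum_(x <- s) t x.1 x.2) = \sum_(x <- s) pi (t x.1 x.2).
  elim: (s) => [|x s' IHs]; first by rewrite !big_nil (linmap0 lin).
  by rewrite !big_cons -[t _ _]scale1r lin IHs !scale1r.
have : pi (\sum_(x <- s) t x.1 x.2) = pi 0.
  rewrite pi_sum (linmap0 lin); apply: (van _ _ bil) => m n An.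
  rewrite -(linmap0 lin); apply/ker; rewrite subr0; exists [:: (m, n)].
  by rewrite big_seq1; split=> // x; rewrite inE => /eqP ->.
move=> /ker; rewrite subr0 => -[y [Ay /tlift sy]].
by exists y; split=> // P beta; exact: sy.
Qed.

End Support.

(* Zorn_bigcup needs the empty union to be admissible, whence the added [0]. *)
Lemma maximal_submodule (R : pzRingType) (N : lmodType R) (l : seq N) (n : N) :
  n \in l -> n != 0 ->
  exists A : N -> Prop, [/\ submodule A,
    exists2 x, x \in l & ~ A x &
    forall B : N -> Prop, submodule B -> (forall x, A x -> B x) ->
      (exists2 x, B x & ~ A x) -> forall x, x \in l -> B x].
Proof.
move=> nl n0.
pose add0 (A : set N) : N -> Prop := fun x => x = 0 \/ A x.
pose adm (A : set N) := submodule (add0 A) /\ exists2 x, x \in l & ~ add0 A x.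
have [F admF totF|A [[subA [x0 x0l Ax0]] maxA]] := @Zorn_bigcup N adm.
  split.
    split; first by left.
    move=> r x y [->|[X FX Xx]]; first by rewrite scaler0 add0r.
    move=> [->|[Y FY Yy]].
      have [subX _] := admF X FX.
      by have [||h|h] := subX.2 r x 0; [right|left|left|right; exists X].
    have [XY|YX] := totF X Y FX FY.
      have [subY _] := admF Y FY.
      by have [||h|h] := subY.2 r x y; [right; exact: XY|right|left|right; exists Y].
    have [subX _] := admF X FX.
    by have [||h|h] := subX.2 r x y; [right|right; exact: YX|left|right; exists X].
  apply: contrapT => noesc.
  have allF x : x \in l -> add0 (\bigcup_(X in F) X)%classic x.
    by move=> xl; apply: contrapT => Fx; apply: noesc; exists x.
  (* The chain is total and [l] finite, so one member contains all of [l] up to zero. The nonzero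
     [n] shows that the chain is nonempty, which starts the induction. *)
  have [X FX lX] : exists2 X, F X & forall x, x \in l -> add0 X x.
    have [Y FY _] : exists2 Y, F Y & Y n.
      by have [n00|[Y]] := allF n nl; [rewrite n00 eqxx in n0|exists Y].
    elim: l allF {nl noesc admF adm} => [|x l IHl] allF; first by exists Y.
    have [|X FX lX] := IHl; first by move=> z zl; apply: allF; rewrite inE zl orbT.
    have [x00|[Z FZ Zx]] := allF x (mem_head _ _).
      by exists X => // z; rewrite inE => /orP[/eqP->|/lX //]; left.
    have [XZ|ZX] := totF X Z FX FZ.
      exists Z => // z; rewrite inE => /orP[/eqP->|/lX[|Xz]]; [by right|by left|].
      by right; exact: XZ.
    exists X => // z; rewrite inE => /orP[/eqP->|/lX //].
    by right; exact: ZX.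
  by have [_ [x xl]] := admF X FX; apply; exact: lX.
exists (add0 A); split=> //; first by exists x0.
move=> B subB AB [b Bb nAb] x xl; apply: contrapT => nBx.
have B0 : add0 B = B.
  by apply/funext => z; apply/propext; split=> [[->|//]|]; [case: subB|right].
apply: (maxA B); last by split; rewrite B0 //; exists x.
split=> [z Az|BA]; first by apply: AB; right.
by apply: nAb; right; exact: BA.
Qed.

(** * Sufficiency of the three conditions *)

Lemma submodule_add_cyclic (R : comPzRingType) (N : lmodType R) (A : N -> Prop) (n : N) :
  submodule A -> submodule (fun x => exists r, A (x - r *: n)).
Proof.
move=> subA; split; first by exists 0; rewrite scale0r subrr; case: subA.
move=> r x y [a Ax] [b Ay]; exists (r * a + b).
have -> : r *: x + y - (r * a + b) *: n = r *: (x - a *: n) + (y - b *: n).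
  by rewrite scalerBr scalerDl scalerA opprD addrACA.
exact: subA.2.
Qed.

Section Converse.
Variables (R : comPzRingType) (M : lmodType R).
Hypotheses (flM : flat M) (mlM : mittag_leffler M).
Hypothesis resM : forall m : R -> Prop, maximal_ideal m ->
  forall (k : comPzRingType) (pi : {rmorphism R -> k}),
    quotient_by m pi -> residue_map_injective M pi.

(** Modulo [A], the second entries of [y] span a simple module, isomorphic to [R/I] with [I]
    maximal. The element of [M (x) R/I] given by [y] is killed by [M^*], so it vanishes by
    injectivity at [I]. *)
Lemma residue_vanishes_mod (N : lmodType R) (y : seq (M * N)) (A : N -> Prop) :
  (forall w : M -> R, lin_form w -> \sum_(x <- y) w x.1 *: x.2 = 0) ->
  submodule A -> (exists2 x, x \in y & ~ A x.2) ->
  (forall B : N -> Prop, submodule B -> (forall n, A n -> B n) ->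
     (exists2 n, B n & ~ A n) -> forall x, x \in y -> B x.2) ->
  vanishes_mod A y.
Proof.
move=> wy0 subA [[m0 n0] /= y0 An0] maxA.
(* [A + R n] properly contains [A], so it contains the second entries of [y]. *)
have gen n x : ~ A n -> x \in y -> exists r, A (x.2 - r *: n).
  move=> An xy.
  apply: (maxA (fun z => exists r, A (z - r *: n))) => //.
  - exact: submodule_add_cyclic.
  - by move=> z Az; exists 0; rewrite scale0r subr0.
  - by exists n => //; exists 1; rewrite scale1r subrr; case: subA.
pose I r := A (r *: n0).
have idI : ideal I.
  split; rewrite /I.
  - by rewrite scale0r; case: subA.
  - by move=> a b Ia Ib; rewrite scalerDl; exact: submoduleD.
  - by move=> r a Ia; rewrite -scalerA; exact: submoduleZ.
have maxI : maximal_ideal I.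
  split=> //; first by rewrite /I scale1r.
  move=> J [J0 JD JM] IJ.
  have [JI|/existsNP[a]] := pselect (forall a, J a -> I a); first by left; split; auto.
  move=> /not_implyP[Ja Ia]; right.
  (* As [a *: n0] is outside [A], it generates [n0] modulo [A], which puts [1 - r * a] in [I]. *)
  have [r Ar] := gen _ _ Ia y0.
  have -> : 1 = (1 - r * a) + r * a by rewrite subrK.
  apply: JD; last exact: JM.
  by apply: IJ; rewrite /I scalerBl scale1r -scalerA.
have [k [pi [sur ker]]] := quotient_ring idI.
(* [c x] is the coordinate of [x.2] along [n0] modulo [A]; the value 0 outside [y] makes [c]
   total. *)
have /choice[c cE] : forall x, exists r, x \in y -> A (x.2 - r *: n0).
  move=> x; have [xy|_] := boolP (x \in y); last by exists 0.
  by have [r Ar] := gen _ _ An0 xy; exists r.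
have tz0 : @tz R M k +%R (fun r a => pi r * a) [seq (x.1, pi (c x)) | x <- y].
  apply: (resM maxI) => // w linw; rewrite big_map.
  under eq_bigr do rewrite -rmorphM.
  rewrite -rmorph_sum; apply/ker; rewrite /I scaler_suml.
  have -> : \sum_(x <- y) (w x.1 * c x) *: n0
          = \sum_(x <- y) w x.1 *: x.2 - \sum_(x <- y) w x.1 *: (x.2 - c x *: n0).
    by rewrite -sumrB; apply: eq_bigr => x _; rewrite scalerBr opprB addrC subrK scalerA.
  rewrite wy0 // sub0r; apply: submoduleN => //.
  rewrite big_seq; elim/big_ind: _ => [|u v|x xy]; first by case: subA.
    exact: submoduleD.
  by apply: submoduleZ => //; exact: cE.
move=> P beta bil beta0.
have [rep repK] := choice sur.
have betaE m r r' : pi r = pi r' -> beta m (r *: n0) = beta m (r' *: n0).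
  move=> eq_pi; apply/eqP; rewrite -subr_eq0 -(is_bilinearNr bil) -(is_bilinearDr bil).
  by rewrite -scalerBl; apply/eqP/beta0/ker; rewrite rmorphB eq_pi subrr.
(* The pullback of [beta] along [R/I -> N/A], [r |-> r *: n0], well defined by [betaE]. *)
have bil' : is_bilinear (fun m (a : restrict pi k^o) => beta m (rep a *: n0)).
  apply: is_bilinearI => r m m' a.
    by rewrite (is_bilinearDl bil) (is_bilinearZl bil).
  rewrite -(is_bilinearZr bil) -(is_bilinearDr bil) scalerA -scalerDl.
  by apply: betaE; rewrite rmorphD rmorphM !repK.
have := tz0 _ _ bil'; rewrite big_map; apply: etrans.
apply: eq_big_seq => x xy /=; rewrite (betaE _ _ (c x)) ?repK //.
apply/eqP; rewrite -subr_eq0 -(is_bilinearNr bil) -(is_bilinearDr bil).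
by apply/eqP/beta0/cE.
Qed.

Lemma flat_mittag_leffler_universally_torsionless : universally_torsionless M.
Proof.
move=> N s ws0; apply: contrapT => nts.
have [y [sy Ey]] := vanishes_mod_repr (support_submodule s)
  (vanishes_mod_support flM mlM (s := s)).
have [z zy z0] : exists2 z, z \in y & z.2 != 0.
  apply: contrapT => y0; apply: nts => P beta bil; rewrite Ey // big1_seq // => x /= xy.
  have [->|x0] := eqVneq x.2 0; first exact: is_bilinear0r bil _.
  by case: y0; exists x.
have [A [subA [_ /mapP[x xy ->] Ax] maxA]] := maximal_submodule (map_f snd zy) z0.
(* [x.2] lies in the support of [s] but outside [A], so it is contradictory for [s] to vanish modulo
   [A]; there [y] can replace [s]. *)
apply/Ax/(sy _ xy A subA) => P beta bil beta0; rewrite Ey //.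
apply: (residue_vanishes_mod _ subA) bil beta0 => //.
- by move=> w linw; rewrite -(Ey _ _ (lin_form_bilinear N linw)) ws0.
- by exists x.
- by move=> B subB AB nBA u uy; apply: (maxA B subB AB nBA); exact: map_f.
Qed.

End Converse.

Theorem theorem6p16 (R : comPzRingType) (M : lmodType R) :
  dually_separated_dual M <->
  [/\ flat M, mittag_leffler M &
      forall (m : R -> Prop), maximal_ideal m ->
      forall (k : comPzRingType) (pi : {rmorphism R -> k}),
        quotient_by m pi -> residue_map_injective M pi].
Proof.
split=> [/dually_separated_universally_torsionless tlM|[flM mlM resM]].
  split; first exact: universally_torsionless_flat.
    exact: universally_torsionless_mittag_leffler.
  by move=> m _ k pi _; exact: universally_torsionless_residue.
apply: universally_torsionless_dually_separated.
exact: flat_mittag_leffler_universally_torsionless.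
Qed.
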